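(* Let $m,n\in\mathbb{N}$, $0<\ell\le\infty$, and let $Q_1(x)$, $Q_0(x)$ be $m\times m$ matrix functions, locally summable on $[0,\ell)$. Consider the system $$y'(x,\lambda)=-\big(\lambda Q_1(x)+Q_0(x)\big)y(x,\lambda)\qquad(y'=\tfrac{d}{dx}y).$$ Let $A_1,A_2,S(0)$ be $n\times n$ matrices and $\Pi_1(0),\Pi_2(0)$ be $n\times m$ matrices satisfying $$A_1S(0)-S(0)A_2=\Pi_1(0)\Pi_2(0)^*.$$ Define $\Pi_1(x),\Pi_2(x),S(x)$ on $[0,\ell)$ by these initial values and $$\Pi_1'=A_1\Pi_1Q_1+\Pi_1Q_0,\qquad (\Pi_2^* )'=-Q_1\Pi_2^*A_2-Q_0\Pi_2^*,\qquad S'=\Pi_1Q_1\Pi_2^*,$$ and for $\lambda$ not an eigenvalue of $A_1$ set $$w_A(x,\lambda)=I_m-\Pi_2(x)^*S(x)^{-1}(A_1-\lambda I_n)^{-1}\Pi_1(x).$$ Let $y(x,\lambda)$ satisfy the system above. Then, at the points $x$ where $S(x)$ is invertible (i.e., on any subinterval of $[0,\ell)$ on which $S(x)$ is invertible), the function $\widetilde y(x,\lambda):=w_A(x,\lambda)y(x,\lambda)$ satisfies $$\widetilde y'(x,\lambda)=-\big(\lambda Q_1(x)+\widetilde Q_0(x)\big)\widetilde y(x,\lambda),$$ where $\widetilde Q_0(x)=Q_0(x)-\big(Q_1(x)X(x)-X(x)Q_1(x)\big)$ and $X(x)=\Pi_2(x)^*S(x)^{-1}\Pi_1(x)$.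
   Context: $I_n$ is the $n\times n$ identity matrix and $H^*$ denotes the conjugate transpose of a matrix $H$. Differential equations with locally summable coefficients are understood for absolutely continuous solutions, almost everywhere. *)

(* Defs.v *)
From HB Require Import structures.
From mathcomp Require Import all_boot all_order all_algebra.
From mathcomp Require Import complex.
From mathcomp Require Import all_classical all_reals all_analysis.

Set Implicit Arguments.
Unset Strict Implicit.
Unset Printing Implicit Defensive.

Import Order.TTheory GRing.Theory Num.Theory.
Local Open Scope classical_set_scope.
Local Open Scope ring_scope.

Section Defs.
Variable R : realType.
Local Notation C := (R[i]).

Definition conjT p q (H : 'M[C]_(p, q)) : 'M[C]_(q, p) :=
  map_mx (@conjc R) H^T.

Definition Ival (l : \bar R) : set R :=
  [set x : R | 0 <= x /\ (x%:E < l)%E].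

Definition abs_cont_on (a b : R) (g : R -> R) : Prop :=
  forall e : R, 0 < e -> exists2 d : R, 0 < d &
    forall (k : nat) (u v : 'I_k -> R),
      (forall i, a <= u i /\ u i <= v i /\ v i <= b) ->
      (forall i j, i != j -> v i <= u j \/ v j <= u i) ->
      \sum_(i < k) (v i - u i) < d ->
      \sum_(i < k) `|g (v i) - g (u i)| < e.

Definition mx_abs_cont_on p q (a b : R) (F : R -> 'M[C]_(p, q)) : Prop :=
  forall i j, abs_cont_on a b (fun x => complex.Re (F x i j)) /\
              abs_cont_on a b (fun x => complex.Im (F x i j)).

Definition mx_has_deriv p q (F : R -> 'M[C]_(p, q)) (x : R)
    (D : 'M[C]_(p, q)) : Prop :=
  forall i j,
    (derivable (fun t => complex.Re (F t i j)) x 1 /\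
     derive1 (fun t => complex.Re (F t i j)) x = complex.Re (D i j)) /\
    (derivable (fun t => complex.Im (F t i j)) x 1 /\
     derive1 (fun t => complex.Im (F t i j)) x = complex.Im (D i j)).

Definition mx_ode_sol p q (I : set R) (F G : R -> 'M[C]_(p, q)) : Prop :=
  (forall a b, I a -> I b -> a <= b -> mx_abs_cont_on a b F) /\
  {ae (@lebesgue_measure R), forall x, I x -> mx_has_deriv F x (G x)}.

Definition loc_summable p q (l : \bar R) (Q : R -> 'M[C]_(p, q)) : Prop :=
  forall b : R, 0 <= b -> (b%:E < l)%E -> forall i j,
    (@lebesgue_measure R).-integrable `[0, b]
        (fun x => (complex.Re (Q x i j))%:E) /\
    (@lebesgue_measure R).-integrable `[0, b]
        (fun x => (complex.Im (Q x i j))%:E).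

Definition wA m n (A1 : 'M[C]_n) (Pi1 Pi2 : R -> 'M[C]_(n, m))
    (S : R -> 'M[C]_n) (lam : C) (x : R) : 'M[C]_m :=
  1%:M - conjT (Pi2 x) *m invmx (S x) *m invmx (A1 - lam%:M) *m Pi1 x.

Definition Xfun m n (Pi1 Pi2 : R -> 'M[C]_(n, m)) (S : R -> 'M[C]_n)
    (x : R) : 'M[C]_m :=
  conjT (Pi2 x) *m invmx (S x) *m Pi1 x.

Definition Q0tilde m n (Q1 Q0 : R -> 'M[C]_m) (Pi1 Pi2 : R -> 'M[C]_(n, m))
    (S : R -> 'M[C]_n) (x : R) : 'M[C]_m :=
  Q0 x - (Q1 x *m Xfun Pi1 Pi2 S x - Xfun Pi1 Pi2 S x *m Q1 x).

End Defs.

(* Main.v *)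
(* The defect A1 S - S A2 - Pi1 Pi2^* is absolutely continuous with derivative
   zero almost everywhere and vanishes at 0, so it vanishes identically. With
   this identity, the product rule and (S^-1)' = - S^-1 S' S^-1 give
     w_A' = w_A (lam Q1 + Q0) - (lam Q1 + Q0tilde) w_A,
   and the equation for w_A y follows from that for y. *)
Require Import Defs.
From HB Require Import structures.
From mathcomp Require Import all_boot all_order all_algebra ring lra.
From mathcomp Require Import complex.
From mathcomp Require Import all_classical all_reals all_analysis.

Set Implicit Arguments.
Unset Strict Implicit.
Unset Printing Implicit Defensive.

Import Order.TTheory GRing.Theory Num.Theory numFieldNormedType.Exports.
Local Open Scope classical_set_scope.
Local Open Scope ring_scope.

(** * Induction along a segment and local increments *)

(** The supremum of the points of [[a, b]] satisfying [P] must be [b]. The step at [c] carries [P]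
    from any point just left of [c] to any point just right of it, so at the supremum it both
    attains and passes it. *)
Lemma segment_induction (R : realType) (P : R -> Prop) (a b : R) :
  a <= b -> P a ->
  (forall c, a <= c -> c <= b -> exists2 r : R, 0 < r &
    forall x y, a <= x -> x <= c -> c <= y -> y <= b ->
      c - r < x -> y < c + r -> P x -> P y) ->
  P b.
Proof.
move=> ab Pa step.
pose E := [set x : R | [/\ a <= x, x <= b & P x]].
have Ea : E a by [].
have supE : has_sup E by split; [exists a | exists b => x []].
have aS : a <= sup E by apply: sup_upper_bound.
have Sb : sup E <= b by apply: ge_sup => [|x []]; first by exists a.
have [r r0 Hr] := step _ aS Sb.
have [x [ax xb Px] xS] := sup_adherent r0 supE.
have xs : x <= sup E by apply: sup_upper_bound.
have [Seqb|Sltb] : sup E = b \/ sup E < b.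
  by move: Sb; rewrite le_eqVlt => /orP[/eqP|]; [left|right].
  by rewrite -Seqb; apply: (Hr x) => //; lra.
(* Half of [r] keeps [y] within reach of the step, the cap at [b] keeps it in the segment; [P y]
   beyond the supremum is absurd. *)
pose y := Num.min b (sup E + r / 2).
have yb : y <= b by rewrite ge_min lexx.
have yS : y <= sup E + r / 2 by rewrite ge_min lexx orbT.
have Sy : sup E < y by rewrite lt_min Sltb /=; lra.
suff : E y by move/(sup_upper_bound supE); lra.
by split => //; [lra|apply: (Hr x) => //; lra].
Qed.

(** Near [c] the difference quotient is below [e]; the point [y = c], where there is no quotient, is
    trivial. *)
Lemma is_derive0_small_increment (R : realType) (f : R -> R) (c e : R) :
  is_derive c (1 : R) f 0 -> 0 < e ->
  exists2 r : R, 0 < r &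
    forall y, `|y - c| < r -> `|f y - f c| <= e * `|y - c|.
Proof.
move=> [df f0] e0.
have /cvgrPdist_lt /(_ e e0) := df.
rewrite -/(derive f c 1) f0 => /= /nbhs_ballP[r /= r0 Hr].
exists r => // y yr; have [->|yc] := eqVneq y c.
  by rewrite !subrr normr0 mulr0.
have := Hr (y - c).
rewrite -ball_normE /= sub0r normrN subr_eq0 => /(_ yr yc).
rewrite sub0r normrN scaler1 subrK /GRing.scale /= normrM normfV => /ltW.
by rewrite ler_pdivrMl ?normr_gt0 ?subr_eq0// mulrC.
Qed.

(** * Absolutely continuous functions with derivative zero almost everywhere *)

Section AbsContConstant.
Context {R : realType}.
Local Notation mu := (@lebesgue_measure R).

(* A Cousin-type argument replaces the Vitali covering lemma: the points where
   the derivative is not known to vanish lie in an open [U] of small measure,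
   and along the segment the increment of [f] is controlled by [e' * (x - a)]
   plus its increments over nonoverlapping intervals contained in [U]. *)
Lemma abs_cont_on_deriv0 (a b : R) (f : R -> R) :
  a <= b -> abs_cont_on a b f ->
  {ae mu, forall x, a <= x <= b -> is_derive x (1 : R) f 0} ->
  f b = f a.
Proof.
move=> ab ac [N [mN N0 HN]].
suff small e : 0 < e -> `|f b - f a| <= e.
  apply/eqP; rewrite -subr_eq0 -normr_le0; apply/ler_addgt0Pl => e /small.
  by rewrite addr0.
move=> e0.
(* Slope [e'] costs at most [e / 2] over the whole segment; the [+ 1] keeps the denominator positive
   when [a = b]. The other half of [e] is reserved for the intervals counted in [U]. *)
pose e' := e / (2 * (b - a + 1)).
have ba1 : 0 < b - a + 1 by lra.
have e'0 : 0 < e' by rewrite divr_gt0 ?mulr_gt0.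
have [d d0 Hd] := ac (e / 2) ltac:(lra).
have Noo : (mu N < +oo)%E by rewrite N0 ltry.
have [U [oU NU muU]] := lebesgue_regularity_outer mN Noo d0.
have mU : measurable U by exact: measurable_realfun.open_measurable.
have muUd : (mu U < d%:E)%E.
  rewrite -(setDKU NU) measureU//; last 2 first.
  - exact: measurableD.
  - by rewrite setDE -setIA setICl setI0.
  by rewrite [X in (_ + X)%E](N0 : mu N = 0%E) adde0.
have mUI (i : interval R) : measurable (U `&` [set` i]) by exact: measurableI.
(* Containment of the intervals in [U] is recorded only through their total length. Endpoints are
   indexed by [nat] so that appending an interval needs no casts, and [[a, x[] is half-open so that
   the measure splits additively at [x]. *)
pose Q (x : R) := exists k (u v : nat -> R),
  [/\ forall i, (i < k)%N -> a <= u i /\ u i <= v i /\ v i <= x,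
      forall i j, (i < j < k)%N -> v i <= u j,
      ((\sum_(i < k) (v i - u i))%:E <= mu (U `&` `[a, x[))%E &
      `|f x - f a| <= e' * (x - a) + \sum_(i < k) `|f (v i) - f (u i)|].
have [k [u [v [uv disj musum]]]] : Q b.
  apply: (@segment_induction _ Q a b ab).
    exists 0, (fun=> 0), (fun=> 0); split => //.
    - rewrite big_ord0; exact: measure_ge0.
    - by rewrite big_ord0 !subrr normr0 mulr0 addr0.
  move=> c ac' cb.
  have Uxy (x y : R) : a <= x -> x <= y -> mu (U `&` `[a, y[) =
      (mu (U `&` `[a, x[) + mu (U `&` `[x, y[))%E.
    move=> ax xy; rewrite -measureU; last 3 first.
    - exact: mUI.
    - exact: mUI.
    - apply/seteqP; split => // t /=; rewrite !in_itv /=.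
      by move=> [[_ /andP[_ tx]] [_ /andP[xt _]]]; lra.
    rewrite -setIUr; congr (mu (_ `&` _)).
    apply/seteqP; split => t /=; rewrite !in_itv /=.
      by move=> /andP[at_ ty]; case: (ltP t x) => tx; [left|right]; lra.
    by move=> [|] /andP[? ?]; lra.
  have [cU|cU] := pselect (U c).
    (* Here a ball around [c] lies in [U]: the interval from [x] to [y] is appended to the family,
       and its whole length counts in [U]. *)
    move: oU => /(_ c cU)/nbhs_ballP[r /= r0 Hr].
    exists r => // x y ax xc cy yb cx yc [k [u [v [uv disj musum fx]]]].
    exists k.+1, (fun i => if (i < k)%N then u i else x),
      (fun i => if (i < k)%N then v i else y); split.
    - move=> i; rewrite ltnS leq_eqVlt; case: ltnP => [ik _|ik /orP[|//] _].
        by have [? [? ?]] := uv i ik; lra.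
      lra.
    - move=> i j; rewrite ltnS => /andP[ij jk].
      rewrite (leq_trans ij jk); case: ltnP => [jk'|_].
        by apply: disj; rewrite ij.
      by have [_ [_ ?]] := uv i (leq_trans ij jk).
    - rewrite big_ord_recr /= ltnn; under eq_bigr do rewrite ltn_ord.
      rewrite EFinD (Uxy x y)//; last lra.
      apply: leeD => //.
      suff -> : U `&` `[x, y[ = `[x, y[%classic.
        rewrite lebesgue_measure_itv /= lte_fin; case: ltP => [_|?]; first by [].
        by rewrite lee_fin; lra.
      apply/setIidPr => t /=; rewrite in_itv /= => /andP[xt ty].
      by apply: Hr; rewrite -ball_normE /=; rewrite ltr_distl; lra.
    - rewrite big_ord_recr /= ltnn; under eq_bigr do rewrite ltn_ord.
      have := ler_distD (f x) (f y) (f a).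
      have : e' * (x - a) <= e' * (y - a) by apply: ler_wpM2l; lra.
      by move: fx; lra.
  (* Off [U] the derivative at [c] vanishes: the family is kept, and the increment from [x] to [y],
     taken through [c], is at most [e' * (y - x)]. *)
  have dc : is_derive c (1 : R) f 0.
    apply: contrapT => nd; apply: cU; apply: NU; apply: HN => /= H.
    by apply: nd; apply: H; rewrite ac' cb.
  have [r r0 Hr] := @is_derive0_small_increment _ _ _ _ dc e'0.
  exists r => // x y ax xc cy yb cx yc [k [u [v [uv disj musum fx]]]].
  exists k, u, v; split => //.
  - by move=> i /uv[? [? ?]]; lra.
  - rewrite (Uxy x y)//; last lra.
    by apply: (le_trans musum); rewrite leeDl//; exact: measure_ge0.
  - have := Hr x; have := Hr y.
    rewrite (ger0_norm (_ : 0 <= y - c)); last lra.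
    rewrite (ler0_norm (_ : x - c <= 0)); last lra.
    move=> /(_ ltac:(lra)) h1 /(_ ltac:(lra)) h2.
    have := ler_distD (f x) (f y) (f a).
    have := ler_distD (f c) (f y) (f x).
    rewrite [`|f c - f x|]distrC.
    have -> : e' * (y - a) = e' * (y - c) + e' * - (x - c) + e' * (x - a) by ring.
    lra.
have sumd : \sum_(i < k) (v i - u i) < d.
  rewrite -lte_fin; apply: (le_lt_trans musum); apply: le_lt_trans muUd.
  by apply: le_measure; rewrite ?inE; [exact: mUI|exact: mU|exact: subIsetl].
have := Hd k (fun i => u i) (fun i => v i) (fun i => uv i (ltn_ord i)) _ sumd.
have H (i j : 'I_k) : i != j -> v i <= u j \/ v j <= u i.
  rewrite -val_eqE neq_ltn => /orP[] ij; [left|right].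
    by apply: disj; rewrite ij /=.
  by apply: disj; rewrite ij /=.
move=> /(_ H) hs hf.
have : e' * (b - a) <= e / 2.
  by rewrite /e' mulrAC ler_pdivrMr ?mulr_gt0//; nra.
lra.
Qed.

End AbsContConstant.

(** * Arithmetic of absolutely continuous functions *)

Section AbsContAlgebra.
Context {R : realType}.
Implicit Types (a b : R) (f g h : R -> R).

(** Summing the bound over a family whose total length is below both moduli for [e'] gives at most
    [(M + N) * e'], which is below [e]. Sums, products, inverses and equality on the segment all
    reduce to this estimate. *)
Lemma abs_cont_on_dominated a b f g h (M N : R) :
  0 <= M -> 0 <= N -> abs_cont_on a b f -> abs_cont_on a b g ->
  (forall u v, a <= u -> u <= v -> v <= b ->
    `|h v - h u| <= M * `|f v - f u| + N * `|g v - g u|) ->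
  abs_cont_on a b h.
Proof.
move=> M0 N0 acf acg hfg e e0.
pose e' := e / (2 * (M + N + 1)).
have MN1 : 0 < M + N + 1 by lra.
have e'0 : 0 < e' by rewrite divr_gt0 ?mulr_gt0.
have [d1 d10 H1] := acf _ e'0.
have [d2 d20 H2] := acg _ e'0.
exists (Num.min d1 d2); first by rewrite lt_min d10 d20.
move=> k u v uv disj; rewrite lt_min => /andP[s1 s2].
have {}H1 := H1 k u v uv disj s1; have {}H2 := H2 k u v uv disj s2.
apply: (@le_lt_trans _ _ (M * e' + N * e')); last first.
  rewrite -mulrDl /e' mulrA ltr_pdivrMr ?mulr_gt0//; nra.
have : \sum_(i < k) `|h (v i) - h (u i)| <=
    M * (\sum_(i < k) `|f (v i) - f (u i)|) +
    N * (\sum_(i < k) `|g (v i) - g (u i)|).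
  rewrite !mulr_sumr -big_split /=; apply: ler_sum => i _.
  by have [? [? ?]] := uv i; exact: hfg.
move=> /le_trans; apply; apply: lerD; apply: ler_wpM2l => //; exact: ltW.
Qed.

Lemma abs_cont_on_cst a b (c : R) : abs_cont_on a b (fun=> c).
Proof.
move=> e e0; exists 1 => // k u v _ _ _.
by rewrite big1// => i _; rewrite subrr normr0.
Qed.

Lemma abs_cont_onD a b f g :
  abs_cont_on a b f -> abs_cont_on a b g ->
  abs_cont_on a b (fun x => f x + g x).
Proof.
move=> acf acg; apply: (abs_cont_on_dominated ler01 ler01 acf acg) => u v _ _ _.
by rewrite !mul1r opprD addrACA ler_normD.
Qed.

Lemma eq_abs_cont_on a b f g :
  (forall x, a <= x <= b -> f x = g x) ->
  abs_cont_on a b f -> abs_cont_on a b g.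
Proof.
move=> fg acf.
apply: (abs_cont_on_dominated ler01 (lexx 0) acf acf) => u v au uv vb.
by rewrite mul1r mul0r addr0 !fg//; lra.
Qed.

(** The family made of the single interval between [c] and [t] turns absolute continuity into
    continuity relative to the segment. *)
Lemma abs_cont_on_near a b f c e :
  abs_cont_on a b f -> a <= c <= b -> 0 < e ->
  exists2 r : R, 0 < r &
    forall t, a <= t <= b -> `|t - c| < r -> `|f t - f c| < e.
Proof.
move=> acf /andP[ac cb] e0; have [d d0 Hd] := acf e e0; exists d => // t /andP[at_ tb].
have one (u v : R) : a <= u -> u <= v -> v <= b -> v - u < d ->
    `|f v - f u| < e.
  move=> au uv vb uvd.
  have := Hd 1 (fun=> u) (fun=> v); rewrite !big_ord1; apply => //.
  by move=> i j; rewrite !ord1 eqxx.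
case: (leP c t) => ct tc.
  by apply: one => //; apply: le_lt_trans tc; exact: ler_norm.
by rewrite distrC; apply: one => //; [lra | apply: le_lt_trans tc; rewrite distrC; exact: ler_norm].
Qed.

(** Compactness in the form of segment induction on boundedness over [[a, x]]; crossing [c] replaces
    the bound by the maximum with the local one. *)
Lemma bounded_on_segment a b f :
  (forall c, a <= c <= b -> exists2 r : R, 0 < r &
    exists M : R, forall t, a <= t <= b -> `|t - c| < r -> `|f t| <= M) ->
  exists2 M : R, 0 <= M & forall t, a <= t <= b -> `|f t| <= M.
Proof.
move=> loc; have [ab|ba] := leP a b; last by exists 0 => // t; lra.
suff [M HM] : exists M : R, forall t, a <= t <= b -> `|f t| <= M.
  by exists M => //; apply: le_trans (HM a _); rewrite ?normr_ge0//; lra.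
apply: (@segment_induction _
  (fun x => exists M : R, forall t, a <= t <= x -> `|f t| <= M) a b ab).
  by exists `|f a| => t ta; have -> : t = a by lra.
move=> c ac cb; have [r r0 [M HM]] := loc c ltac:(lra).
exists r => // x y ax xc cy yb cx yc [M' HM'].
exists (Num.max M' M) => t ty; rewrite le_max.
case: (leP t x) => tx; first by rewrite HM'//; lra.
by rewrite (HM t) ?orbT//; [lra|rewrite ltr_distl; lra].
Qed.

Lemma abs_cont_on_bounded a b f :
  abs_cont_on a b f ->
  exists2 M : R, 0 <= M & forall t, a <= t <= b -> `|f t| <= M.
Proof.
move=> acf; apply: bounded_on_segment => c cab.
have [r r0 Hr] := abs_cont_on_near acf cab ltr01.
exists r => //; exists (`|f c| + 1) => t tab tc.
have := Hr t tab tc; have := ler_normD (f t - f c) (f c); rewrite subrK; lra.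
Qed.

Lemma abs_cont_onM a b f g :
  abs_cont_on a b f -> abs_cont_on a b g ->
  abs_cont_on a b (fun x => f x * g x).
Proof.
move=> acf acg.
have [M M0 HM] := abs_cont_on_bounded acf.
have [N N0 HN] := abs_cont_on_bounded acg.
apply: (abs_cont_on_dominated N0 M0 acf acg) => u v au uv vb.
have -> : f v * g v - f u * g u = g v * (f v - f u) + f u * (g v - g u) by ring.
apply: (le_trans (ler_normD _ _)); rewrite !normrM.
by apply: lerD; apply: ler_wpM2r => //; [apply: HN|apply: HM]; lra.
Qed.

(** Near [c], [f] stays above half of its modulus at [c], so the inverse is locally and hence
    globally bounded by some [M]; its increments are then at most [M * M] times those of [f]. *)
Lemma abs_cont_onV a b f :
  (forall x, a <= x <= b -> f x != 0) -> abs_cont_on a b f ->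
  abs_cont_on a b (fun x => (f x)^-1).
Proof.
move=> f0 acf.
have [M M0 HM] : exists2 M : R, 0 <= M &
    forall t, a <= t <= b -> `|(f t)^-1| <= M.
  apply: bounded_on_segment => c cab.
  have fc0 : 0 < `|f c| by rewrite normr_gt0 f0.
  have fc20 : 0 < `|f c| / 2 by lra.
  have [r r0 Hr] := abs_cont_on_near acf cab fc20.
  exists r => //; exists (`|f c| / 2)^-1 => t tab tc.
  rewrite normfV lef_pV2 ?posrE ?normr_gt0 ?f0//.
  have := Hr t tab tc; have := ler_normB (f t) (f t - f c).
  by rewrite opprB addrC subrK; lra.
apply: (abs_cont_on_dominated (mulr_ge0 M0 M0) (lexx 0) acf acf) => u v au uv vb.
rewrite mul0r addr0.
have fu : f u != 0 by apply: f0; lra.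
have fv : f v != 0 by apply: f0; lra.
have -> : (f v)^-1 - (f u)^-1 = (f v)^-1 * (f u)^-1 * - (f v - f u).
  by field; rewrite fu fv.
rewrite !normrM normrN; apply: ler_wpM2r => //.
by apply: ler_pM => //; apply: HM; lra.
Qed.

End AbsContAlgebra.

(** * Real and imaginary parts of complex arithmetic *)

Section ComplexParts.
Context {R : rcfType}.
Implicit Types z w : R[i].

Lemma ReD z w : complex.Re (z + w) = complex.Re z + complex.Re w.
Proof. by case: z w => [a b] [c d]. Qed.

Lemma ImD z w : complex.Im (z + w) = complex.Im z + complex.Im w.
Proof. by case: z w => [a b] [c d]. Qed.

Lemma ReM z w :
  complex.Re (z * w) = complex.Re z * complex.Re w - complex.Im z * complex.Im w.
Proof. by case: z w => [a b] [c d]. Qed.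

Lemma ImM z w :
  complex.Im (z * w) = complex.Re z * complex.Im w + complex.Im z * complex.Re w.
Proof. by case: z w => [a b] [c d]. Qed.

(** The squared modulus is spelled with products so that closure under sums and products applies to
    it directly. *)
Lemma ReV z : complex.Re z^-1 =
  complex.Re z * (complex.Re z * complex.Re z + complex.Im z * complex.Im z)^-1.
Proof. by case: z => [a b]; rewrite -!expr2. Qed.

Lemma ImV z : complex.Im z^-1 =
  - complex.Im z * (complex.Re z * complex.Re z + complex.Im z * complex.Im z)^-1.
Proof. by case: z => [a b]; rewrite mulNr -!expr2. Qed.

Lemma sqr_modulus_neq0 z : z != 0 ->
  complex.Re z * complex.Re z + complex.Im z * complex.Im z != 0.
Proof.
by case: z => [a b]; rewrite eq_complex /= -!expr2 paddr_eq0 ?sqr_ge0// !sqrf_eq0.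
Qed.

End ComplexParts.

(** * Closure of function classes under matrix operations *)

(* Absolute continuity on a segment and differentiability at a point are both
   closed under the arithmetic operations, which is all that is needed of the
   class [K] to control determinants and adjugates. *)
Section ArithmeticClass.
Context {R : realType}.
Variables (K : (R -> R) -> Prop) (D : set R).
Hypothesis K_cst : forall c, K (fun=> c).
Hypothesis K_add : forall f g, K f -> K g -> K (fun x => f x + g x).
Hypothesis K_mul : forall f g, K f -> K g -> K (fun x => f x * g x).
(** [D] is where nonvanishing is demanded: the segment for absolute continuity, the single point for
    differentiability. *)
Hypothesis K_inv :
  forall f, (forall x, D x -> f x != 0) -> K f -> K (fun x => (f x)^-1).

Definition complex_class (f : R -> R[i]) : Prop :=
  K (fun x => complex.Re (f x)) /\ K (fun x => complex.Im (f x)).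

Definition matrix_class p q (F : R -> 'M[R[i]]_(p, q)) : Prop :=
  forall i j, complex_class (fun x => F x i j).

Lemma complex_class_cst (c : R[i]) : complex_class (fun=> c).
Proof. by split; exact: K_cst. Qed.

Lemma complex_classD (f g : R -> R[i]) :
  complex_class f -> complex_class g -> complex_class (fun x => f x + g x).
Proof.
move=> [f1 f2] [g1 g2]; split.
- by under eq_fun do rewrite ReD; exact: K_add.
- by under eq_fun do rewrite ImD; exact: K_add.
Qed.

Let K_opp f : K f -> K (fun x => - f x).
Proof. by move=> Kf; under eq_fun do rewrite -mulN1r; exact: K_mul. Qed.

Lemma complex_classM (f g : R -> R[i]) :
  complex_class f -> complex_class g -> complex_class (fun x => f x * g x).
Proof.
move=> [f1 f2] [g1 g2]; split.
- under eq_fun do rewrite ReM.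
  by apply: K_add; [exact: K_mul|apply: K_opp; exact: K_mul].
- by under eq_fun do rewrite ImM; apply: K_add; exact: K_mul.
Qed.

Lemma complex_classV (f : R -> R[i]) :
  (forall x, D x -> f x != 0) -> complex_class f ->
  complex_class (fun x => (f x)^-1).
Proof.
move=> f0 [f1 f2].
have KN : K (fun x => (complex.Re (f x) * complex.Re (f x) +
    complex.Im (f x) * complex.Im (f x))^-1).
  apply: K_inv => [x Dx|]; first by apply: sqr_modulus_neq0; exact: f0.
  by apply: K_add; exact: K_mul.
split.
- by under eq_fun do rewrite ReV; exact: K_mul.
- by under eq_fun do rewrite ImV; apply: K_mul => //; exact: K_opp.
Qed.

Lemma complex_class_sum (I : Type) (r : seq I) (P : pred I) (f : I -> R -> R[i]) :
  (forall i, complex_class (f i)) ->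
  complex_class (fun x => \sum_(i <- r | P i) f i x).
Proof.
move=> Kf; elim: r => [|i r IH].
  by under eq_fun do rewrite big_nil; exact: complex_class_cst.
under eq_fun do rewrite big_cons; case: (P i) => //.
exact: complex_classD.
Qed.

Lemma complex_class_prod (I : Type) (r : seq I) (P : pred I) (f : I -> R -> R[i]) :
  (forall i, complex_class (f i)) ->
  complex_class (fun x => \prod_(i <- r | P i) f i x).
Proof.
move=> Kf; elim: r => [|i r IH].
  by under eq_fun do rewrite big_nil; exact: complex_class_cst.
under eq_fun do rewrite big_cons; case: (P i) => //.
exact: complex_classM.
Qed.

Lemma matrix_class_cst p q (A : 'M[R[i]]_(p, q)) : matrix_class (fun=> A).
Proof. by move=> i j; exact: complex_class_cst. Qed.

Lemma matrix_classD p q (F G : R -> 'M[R[i]]_(p, q)) :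
  matrix_class F -> matrix_class G -> matrix_class (fun x => F x + G x).
Proof.
move=> KF KG i j; under eq_fun do rewrite mxE.
exact: complex_classD.
Qed.

Lemma matrix_classM p q r (F : R -> 'M[R[i]]_(p, q)) (G : R -> 'M[R[i]]_(q, r)) :
  matrix_class F -> matrix_class G -> matrix_class (fun x => F x *m G x).
Proof.
move=> KF KG i j; under eq_fun do rewrite mxE.
by apply: complex_class_sum => k; exact: complex_classM.
Qed.

Lemma matrix_classN p q (F : R -> 'M[R[i]]_(p, q)) :
  matrix_class F -> matrix_class (fun x => - F x).
Proof.
move=> KF i j; under eq_fun do rewrite mxE -mulN1r.
by apply: complex_classM; [exact: complex_class_cst|exact: KF].
Qed.

(** The Leibniz formula makes the determinant a sum of signed products of entries. *)
Lemma complex_class_det n (F : R -> 'M[R[i]]_n) :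
  matrix_class F -> complex_class (fun x => \det (F x)).
Proof.
move=> KF; apply: complex_class_sum => s.
by apply: complex_classM; [exact: complex_class_cst|exact: complex_class_prod].
Qed.

(* [invmx] is the identity on singular matrices, so regularity of the inverse
   off [D] can only be expressed through the adjugate formula. *)
Lemma matrix_classV n (F : R -> 'M[R[i]]_n) :
  (forall x, D x -> F x \in unitmx) -> matrix_class F ->
  matrix_class (fun x => (\det (F x))^-1 *: \adj (F x)).
Proof.
move=> uF KF i j; under eq_fun do rewrite !mxE.
apply: complex_classM.
  apply: complex_classV => [x /uF|]; first by rewrite unitmxE unitfE.
  exact: complex_class_det.
(* A cofactor is a constant sign times the determinant of a minor of [F]. *)
apply: complex_classM; first exact: complex_class_cst.
apply: complex_class_det => k l.
by under eq_fun do rewrite !mxE; exact: KF.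
Qed.

End ArithmeticClass.

(** * Derivatives of matrix functions at a point *)

Section MatrixDerivative.
Context {R : realType}.

(** [is_derive] bundles existence and value of the derivative, the form in which the calculus rules
    are stated; [mx_has_derivP] links it to [mx_has_deriv]. *)
Definition complex_is_derive (f : R -> R[i]) (x : R) (d : R[i]) : Prop :=
  is_derive x (1 : R) (fun t => complex.Re (f t)) (complex.Re d) /\
  is_derive x (1 : R) (fun t => complex.Im (f t)) (complex.Im d).

Lemma mx_has_derivP p q (F : R -> 'M[R[i]]_(p, q)) x D :
  mx_has_deriv F x D <->
  forall i j, complex_is_derive (fun t => F t i j) x (D i j).
Proof.
split=> H i j; move: (H i j).
  move=> [[h1 e1] [h2 e2]]; rewrite derive1E in e1; rewrite derive1E in e2.
  exact (conj (DeriveDef h1 e1) (DeriveDef h2 e2)).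
move=> [[h1 e1] [h2 e2]]; rewrite !derive1E.
exact (conj (conj h1 e1) (conj h2 e2)).
Qed.

Lemma is_derive_mul (f g : R -> R) (x df dg : R) :
  is_derive x (1 : R) f df -> is_derive x (1 : R) g dg ->
  is_derive x (1 : R) (fun t => f t * g t) (df * g x + f x * dg).
Proof.
move=> Hf Hg; apply: (is_derive_eq (is_deriveM Hf Hg)).
by rewrite /GRing.scale /= addrC (mulrC (g x)).
Qed.

Lemma complex_is_deriveD (f g : R -> R[i]) x df dg :
  complex_is_derive f x df -> complex_is_derive g x dg ->
  complex_is_derive (fun t => f t + g t) x (df + dg).
Proof.
move=> [f1 f2] [g1 g2]; split.
- by under eq_fun do rewrite ReD; rewrite ReD; exact: is_deriveD.
- by under eq_fun do rewrite ImD; rewrite ImD; exact: is_deriveD.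
Qed.

Lemma complex_is_deriveM (f g : R -> R[i]) x df dg :
  complex_is_derive f x df -> complex_is_derive g x dg ->
  complex_is_derive (fun t => f t * g t) x (df * g x + f x * dg).
Proof.
move=> [f1 f2] [g1 g2]; split.
- under eq_fun do rewrite ReM.
  apply: (is_derive_eq (is_deriveB (is_derive_mul f1 g1) (is_derive_mul f2 g2))).
  by rewrite ReD !ReM; ring.
- under eq_fun do rewrite ImM.
  apply: (is_derive_eq (is_deriveD (is_derive_mul f1 g2) (is_derive_mul f2 g1))).
  by rewrite ImD !ImM; ring.
Qed.

Lemma complex_is_derive_cst (c : R[i]) x : complex_is_derive (fun=> c) x 0.
Proof. by split; exact: is_derive_cst. Qed.

Lemma complex_is_derive_sum (I : Type) (r : seq I) (f : I -> R -> R[i]) x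
    (d : I -> R[i]) :
  (forall i, complex_is_derive (f i) x (d i)) ->
  complex_is_derive (fun t => \sum_(i <- r) f i t) x (\sum_(i <- r) d i).
Proof.
move=> H; elim: r => [|i r IH].
  rewrite big_nil; under eq_fun do rewrite big_nil.
  exact: complex_is_derive_cst.
rewrite big_cons; under eq_fun do rewrite big_cons.
exact: complex_is_deriveD.
Qed.

Lemma mx_has_deriv_cst p q (A : 'M[R[i]]_(p, q)) x :
  mx_has_deriv (fun=> A) x 0.
Proof.
by apply/mx_has_derivP => i j; rewrite mxE; exact: complex_is_derive_cst.
Qed.

Lemma mx_has_derivD p q (F G : R -> 'M[R[i]]_(p, q)) x DF DG :
  mx_has_deriv F x DF -> mx_has_deriv G x DG ->
  mx_has_deriv (fun t => F t + G t) x (DF + DG).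
Proof.
move=> /mx_has_derivP HF /mx_has_derivP HG; apply/mx_has_derivP => i j.
by rewrite mxE; under eq_fun do rewrite mxE; exact: complex_is_deriveD.
Qed.

Lemma mx_has_derivM p q r (F : R -> 'M[R[i]]_(p, q)) (G : R -> 'M[R[i]]_(q, r))
    x DF DG :
  mx_has_deriv F x DF -> mx_has_deriv G x DG ->
  mx_has_deriv (fun t => F t *m G t) x (DF *m G x + F x *m DG).
Proof.
move=> /mx_has_derivP HF /mx_has_derivP HG; apply/mx_has_derivP => i j.
rewrite !mxE -big_split; under eq_fun do rewrite mxE.
by apply: complex_is_derive_sum => k; exact: complex_is_deriveM.
Qed.

Lemma mx_has_derivN p q (F : R -> 'M[R[i]]_(p, q)) x DF :
  mx_has_deriv F x DF -> mx_has_deriv (fun t => - F t) x (- DF).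
Proof.
move=> /mx_has_derivP HF; apply/mx_has_derivP => i j.
rewrite mxE -mulN1r; under eq_fun do rewrite mxE -mulN1r.
have := complex_is_deriveM (complex_is_derive_cst (-1) x) (HF i j).
by rewrite mul0r add0r.
Qed.

Lemma mx_has_deriv_unique p q (F : R -> 'M[R[i]]_(p, q)) x D1 D2 :
  mx_has_deriv F x D1 -> mx_has_deriv F x D2 -> D1 = D2.
Proof.
move=> H1 H2; apply/matrixP => i j; apply/eqP; rewrite eq_complex.
have [[_ <-] [_ <-]] := H1 i j.
by have [[_ <-] [_ <-]] := H2 i j; rewrite !eqxx.
Qed.

Lemma near_eq_mx_has_deriv p q (F G : R -> 'M[R[i]]_(p, q)) (x : R) D :
  (\forall t \near x, F t = G t) -> mx_has_deriv F x D -> mx_has_deriv G x D.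
Proof.
move=> FG /mx_has_derivP HF; apply/mx_has_derivP => i j.
have [h1 h2] := HF i j; split.
- by apply: near_eq_is_derive h1; apply: filterS FG => t ->.
- by apply: near_eq_is_derive h2; apply: filterS FG => t ->.
Qed.

Section DerivableAt.
Variable x : R.

(** Derivability at the fixed [x] as an instance of the arithmetic class, with the singleton of [x]
    for [D]. *)
Let derivable_at (f : R -> R) := derivable f x (1 : R).

Let derivable_at_cst c : derivable_at (fun=> c).
Proof. exact: derivable_cst. Qed.

Let derivable_atD f g :
  derivable_at f -> derivable_at g -> derivable_at (fun t => f t + g t).
Proof. by move=> df dg; exact: (derivableD df dg). Qed.

Let derivable_atM f g :
  derivable_at f -> derivable_at g -> derivable_at (fun t => f t * g t).
Proof. by move=> df dg; exact: (derivableM df dg). Qed.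

Let derivable_atV f : (forall t, [set x] t -> f t != 0) ->
  derivable_at f -> derivable_at (fun t => (f t)^-1).
Proof. by move=> f0 df; apply: derivableV => //; exact: f0. Qed.

Let mx_has_deriv_class n (F : R -> 'M[R[i]]_n) D :
  mx_has_deriv F x D -> matrix_class derivable_at F.
Proof. by move=> HF i j; have [[h1 _] [h2 _]] := HF i j; exact (conj h1 h2). Qed.

(** The squared modulus of the determinant is derivable, hence continuous, at [x], and so remains
    nonzero nearby. *)
Lemma unitmx_near n (F : R -> 'M[R[i]]_n) D :
  mx_has_deriv F x D -> F x \in unitmx -> \forall t \near x, F t \in unitmx.
Proof.
move=> /mx_has_deriv_class HF uF.
have [d1 d2] :=
  complex_class_det derivable_at_cst derivable_atD derivable_atM HF.
pose g t := complex.Re (\det (F t)) * complex.Re (\det (F t)) +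
  complex.Im (\det (F t)) * complex.Im (\det (F t)).
have dg : derivable g x 1 :=
  derivable_atD (derivable_atM d1 d1) (derivable_atM d2 d2).
have cg : {for x, continuous g}.
  by apply: differentiable_continuous; exact/derivable1_diffP.
have g0 : g x != 0.
  by apply: sqr_modulus_neq0; rewrite -unitfE -unitmxE.
have : \forall t \near x, g t != 0.
  exact: cvgr_neq0 cg g0.
apply: filterS => t; apply: contraNT; rewrite unitmxE unitfE negbK /g => /eqP ->.
by rewrite !mulr0 addr0.
Qed.

(** Near [x] the inverse is the adjugate formula [J], which is differentiable with some derivative
    [E]; differentiating [F J = 1] then identifies [E]. *)
Lemma mx_has_derivV n (F : R -> 'M[R[i]]_n) D :
  mx_has_deriv F x D -> F x \in unitmx ->
  mx_has_deriv (fun t => invmx (F t)) x (- (invmx (F x) *m D *m invmx (F x))).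
Proof.
move=> HF uF.
have uFx t : [set x] t -> F t \in unitmx by move=> ->.
pose J t := (\det (F t))^-1 *: \adj (F t).
have KJ : matrix_class derivable_at J := matrix_classV derivable_at_cst
  derivable_atD derivable_atM derivable_atV uFx (mx_has_deriv_class HF).
have JF : \forall t \near x, J t = invmx (F t).
  by apply: filterS (unitmx_near HF uF) => t uFt; rewrite /invmx uFt.
apply: near_eq_mx_has_deriv JF _.
pose E := \matrix_(i, j) Complex
  ('D_1 (fun t => complex.Re (J t i j)) x) ('D_1 (fun t => complex.Im (J t i j)) x).
have HJ : mx_has_deriv J x E.
  apply/mx_has_derivP => i j; have [h1 h2] := KJ i j; rewrite mxE.
  exact (conj (derivableP h1) (derivableP h2)).
have H1 : mx_has_deriv (fun t => F t *m J t) x 0.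
  apply: near_eq_mx_has_deriv (mx_has_deriv_cst 1%:M x).
  apply: filterS (unitmx_near HF uF) => t uFt.
  by rewrite -(mulmxV uFt) /invmx uFt.
have Jx : J x = invmx (F x) by rewrite /J /invmx uF.
(* Uniqueness gives [D *m J x + F x *m E = 0], to be solved for [E]. *)
have := mx_has_deriv_unique (mx_has_derivM HF HJ) H1.
rewrite Jx => /eqP; rewrite addrC addr_eq0 => /eqP FE.
by rewrite -mulmxA -mulmxN -FE mulKmx.
Qed.

End DerivableAt.

End MatrixDerivative.

(** * Almost everywhere statements and solutions of matrix equations *)

Section AlmostEverywhere.
Context {R : realType}.
Local Notation mu := (@lebesgue_measure R).

Lemma ae_imply (P Q : R -> Prop) :
  (forall x, P x -> Q x) -> {ae mu, forall x, P x} -> {ae mu, forall x, Q x}.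
Proof. by move=> PQ; exact: (@filterS _ _ (ae_filter_ringOfSetsType mu)). Qed.

Lemma ae_and (P Q : R -> Prop) :
  {ae mu, forall x, P x} -> {ae mu, forall x, Q x} ->
  {ae mu, forall x, P x /\ Q x}.
Proof. exact: (@filterI _ _ (ae_filter_ringOfSetsType mu)). Qed.

End AlmostEverywhere.

Section OdeSolutions.
Context {R : realType}.

Lemma eq_mx_abs_cont_on p q (a b : R) (F G : R -> 'M[R[i]]_(p, q)) :
  (forall x, a <= x <= b -> F x = G x) ->
  mx_abs_cont_on a b F -> mx_abs_cont_on a b G.
Proof.
move=> FG HF i j; have [h1 h2] := HF i j.
by split; [apply: eq_abs_cont_on h1 | apply: eq_abs_cont_on h2] => x /FG ->.
Qed.

Lemma mx_abs_cont_on_cst p q (a b : R) (A : 'M[R[i]]_(p, q)) :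
  mx_abs_cont_on a b (fun=> A).
Proof. exact: (matrix_class_cst (@abs_cont_on_cst R a b)). Qed.

Lemma mx_abs_cont_onD p q (a b : R) (F G : R -> 'M[R[i]]_(p, q)) :
  mx_abs_cont_on a b F -> mx_abs_cont_on a b G ->
  mx_abs_cont_on a b (fun x => F x + G x).
Proof. exact: (matrix_classD (@abs_cont_onD R a b)). Qed.

Lemma mx_abs_cont_onN p q (a b : R) (F : R -> 'M[R[i]]_(p, q)) :
  mx_abs_cont_on a b F -> mx_abs_cont_on a b (fun x => - F x).
Proof.
exact: (matrix_classN (@abs_cont_on_cst R a b) (@abs_cont_onD R a b)
  (@abs_cont_onM R a b)).
Qed.

Lemma mx_abs_cont_onM p q r (a b : R)
    (F : R -> 'M[R[i]]_(p, q)) (G : R -> 'M[R[i]]_(q, r)) :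
  mx_abs_cont_on a b F -> mx_abs_cont_on a b G ->
  mx_abs_cont_on a b (fun x => F x *m G x).
Proof.
exact: (matrix_classM (@abs_cont_on_cst R a b) (@abs_cont_onD R a b)
  (@abs_cont_onM R a b)).
Qed.

Lemma mx_abs_cont_onV n (a b : R) (F : R -> 'M[R[i]]_n) :
  (forall x, a <= x <= b -> F x \in unitmx) -> mx_abs_cont_on a b F ->
  mx_abs_cont_on a b (fun x => invmx (F x)).
Proof.
move=> uF HF.
apply: (@eq_mx_abs_cont_on _ _ _ _ (fun x => (\det (F x))^-1 *: \adj (F x))).
  by move=> x /uF uFx; rewrite /invmx uFx.
exact: (matrix_classV (D := [set x | a <= x <= b]) (@abs_cont_on_cst R a b)
  (@abs_cont_onD R a b) (@abs_cont_onM R a b) (@abs_cont_onV R a b)).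
Qed.

(** Real and imaginary parts of each entry fall under [abs_cont_on_deriv0]; since [I] is an
    interval, the derivative is known almost everywhere on all of [[a, b]]. *)
Lemma mx_ode_sol_cst p q (I : set R) (F : R -> 'M[R[i]]_(p, q)) (a b : R) :
  is_interval I -> mx_ode_sol I F (fun=> 0) -> I a -> I b -> a <= b -> F b = F a.
Proof.
move=> itvI [acF dF] Ia Ib ab.
have dF' : {ae (@lebesgue_measure R), forall x, a <= x <= b -> mx_has_deriv F x 0}.
  by apply: ae_imply dF => x dFx xab; apply: dFx; exact: itvI Ia Ib x xab.
apply/matrixP => i j; apply/eqP; rewrite eq_complex.
have [ac1 ac2] := acF a b Ia Ib ab i j.
apply/andP; split; apply/eqP.
- apply: (abs_cont_on_deriv0 ab ac1); apply: ae_imply dF' => x dFx /dFx.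
  by move=> /mx_has_derivP /(_ i j); rewrite mxE => -[].
- apply: (abs_cont_on_deriv0 ab ac2); apply: ae_imply dF' => x dFx /dFx.
  by move=> /mx_has_derivP /(_ i j); rewrite mxE => -[].
Qed.

End OdeSolutions.

(** * Matrix algebra of the transfer function *)

(** The eigenspace is the kernel of [A - a%:M] on row vectors, and a square matrix with trivial
    kernel is invertible. *)
Lemma eigenvalueN_unitmx (F : fieldType) n (A : 'M[F]_n) (a : F) :
  ~~ eigenvalue A a -> A - a%:M \in unitmx.
Proof. by rewrite /eigenvalue negbK /eigenspace kermx_eq0 row_free_unit. Qed.

(* With [u = 1 - w_A], the operator identity [A1 S - S A2 = Pi P] and the
   resolvent [B] reduce every term to the noncommuting [Q0], [Q1], [X], [u]. *)
Lemma darboux_matrix_derivative (C : comNzRingType) m n (A1 A2 S T B : 'M[C]_n)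
    (Pi : 'M[C]_(n, m)) (P : 'M[C]_(m, n)) (Q1 Q0 : 'M[C]_m) (lam : C) :
  S *m T = 1%:M -> T *m S = 1%:M ->
  (A1 - lam%:M) *m B = 1%:M -> B *m (A1 - lam%:M) = 1%:M ->
  A1 *m S - S *m A2 = Pi *m P ->
  let X := P *m T *m Pi in
  let W := 1%:M - P *m T *m B *m Pi in
  let DP := - (Q1 *m P *m A2) - Q0 *m P in
  let DT := - (T *m (Pi *m Q1 *m P) *m T) in
  let DPi := A1 *m Pi *m Q1 + Pi *m Q0 in
  - ((DP *m T + P *m DT) *m B *m Pi + P *m T *m B *m DPi) =
  W *m (lam *: Q1 + Q0) - (lam *: Q1 + (Q0 - (Q1 *m X - X *m Q1))) *m W.
Proof.
move=> ST TS LB BL id X W DP DT DPi.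
pose u := P *m T *m B *m Pi.
have A1B : A1 *m B = 1%:M + lam *: B.
  by rewrite -LB mulmxBl mul_scalar_mx subrK.
have BA1 : B *m A1 = 1%:M + lam *: B.
  by rewrite -BL mulmxBr mul_mx_scalar subrK.
(* This is [A1 S - S A2 = Pi P] multiplied by [T] on both sides; it moves [A2] past [T], so that
   [A1] meets the resolvent [B] in [E1]. *)
have A2T : A2 *m T = T *m A1 - T *m Pi *m P *m T.
  have -> : T *m Pi *m P *m T = T *m (Pi *m P) *m T by rewrite !mulmxA.
  rewrite -id mulmxBr mulmxBl -!mulmxA ST mulmx1 (mulmxA T S) TS mul1mx.
  by rewrite opprB addrC subrK.
have E2 : P *m T *m B *m A1 *m Pi = X + lam *: u.
  rewrite -(mulmxA (P *m T)) BA1 mulmxDr mulmx1 mulmxDl.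
  by rewrite -scalemxAr -scalemxAl.
have E1 : P *m A2 *m T *m B *m Pi = X + lam *: u - X *m u.
  rewrite -(mulmxA P A2) A2T mulmxBr !mulmxBl; congr (_ - _).
    rewrite -[P *m (T *m A1) *m B]mulmxA -[T *m A1 *m B]mulmxA A1B.
    by rewrite mulmxDr mulmx1 mulmxDr mulmxDl -!scalemxAr -scalemxAl !mulmxA.
  by rewrite /X /u !mulmxA.
have -> : P *m T *m B *m DPi = (X + lam *: u) *m Q1 + u *m Q0.
  by rewrite /DPi mulmxDr -E2 /u !mulmxA.
rewrite !(mulmxDl (DP *m T)) (mulmxDl (DP *m T *m B)).
have -> : DP *m T *m B *m Pi = - (Q1 *m (X + lam *: u - X *m u)) - Q0 *m u.
  by rewrite /DP !mulmxBl !mulNmx -E1 /u !mulmxA.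
have -> : P *m DT *m B *m Pi = - (X *m Q1 *m u).
  by rewrite /DT mulmxN !mulNmx /X /u !mulmxA.
have -> : W = 1%:M - u by [].
rewrite !(mulmxDl, mulmxDr, mulmxBl, mulmxBr, mulmxN, mulNmx, mul1mx, mulmx1).
rewrite -!(scalemxAl, scalemxAr) !mulmxA.
(* Once the noncommuting products are independent matrices, the identity is linear in them and holds
   entrywise. *)
move: (Q1 *m X) (X *m Q1) (Q1 *m u) (u *m Q1) (Q0 *m u) (u *m Q0)
  (Q1 *m X *m u) (X *m Q1 *m u) => M1 M2 M3 M4 M5 M6 M7 M8.
by apply/matrixP => i j; rewrite !mxE; ring.
Qed.

(** * The transformed system *)

(** [y] has [p] columns, so vector solutions and fundamental solutions are covered at once. *)
Theorem theorem2p1 (R : realType) (m n p : nat) (l : \bar R)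
  (Q1 Q0 : R -> 'M[R[i]]_m) (A1 A2 : 'M[R[i]]_n)
  (Pi1 Pi2 : R -> 'M[R[i]]_(n, m)) (S : R -> 'M[R[i]]_n)
  (lam : R[i]) (y : R -> 'M[R[i]]_(m, p)) :
  (0 < l)%E ->
  loc_summable l Q1 -> loc_summable l Q0 ->
  A1 *m S 0 - S 0 *m A2 = Pi1 0 *m conjT (Pi2 0) ->
  mx_ode_sol (Ival l) Pi1
    (fun x => A1 *m Pi1 x *m Q1 x + Pi1 x *m Q0 x) ->
  mx_ode_sol (Ival l) (fun x => conjT (Pi2 x))
    (fun x => - (Q1 x *m conjT (Pi2 x) *m A2) - Q0 x *m conjT (Pi2 x)) ->
  mx_ode_sol (Ival l) S (fun x => Pi1 x *m Q1 x *m conjT (Pi2 x)) ->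
  ~~ eigenvalue A1 lam ->
  mx_ode_sol (Ival l) y (fun x => - ((lam *: Q1 x + Q0 x) *m y x)) ->
  forall I : set R, is_interval I -> I `<=` Ival l ->
    (forall x, I x -> S x \in unitmx) ->
    mx_ode_sol I (fun x => wA A1 Pi1 Pi2 S lam x *m y x)
      (fun x => - ((lam *: Q1 x + Q0tilde Q1 Q0 Pi1 Pi2 S x)
                    *m (wA A1 Pi1 Pi2 S lam x *m y x))).
Proof.
move=> l0 _ _ id0 HPi HP HS nev Hy I itvI Isub uS.
have LU : A1 - lam%:M \in unitmx := eigenvalueN_unitmx nev.
have I0 : Ival l (0 : R) by split.
have itvl : is_interval (Ival l).
  move=> u v [u0 _] [_ vl] x /andP[ux xv]; split; first exact: le_trans u0 ux.
  by apply: le_lt_trans vl; rewrite lee_fin.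
have [acPi dPi] := HPi; have [acP dP] := HP; have [acS dS] := HS.
have [acy dy] := Hy.
have id x : Ival l x -> A1 *m S x - S x *m A2 = Pi1 x *m conjT (Pi2 x).
  (* The defect is spelled with sums and opposites to match the closure rules. *)
  move=> Ix; pose F t := A1 *m S t + (- (S t *m A2) + - (Pi1 t *m conjT (Pi2 t))).
  have F0 : mx_ode_sol (Ival l) F (fun=> 0).
    split=> [a b Ia Ib ab|].
      have cS := acS a b Ia Ib ab; have cst := @mx_abs_cont_on_cst R n n a b.
      apply: mx_abs_cont_onD; first exact: mx_abs_cont_onM.
      apply: mx_abs_cont_onD; apply: mx_abs_cont_onN; first exact: mx_abs_cont_onM.
      by apply: mx_abs_cont_onM; [exact: acPi|exact: acP].
    apply: ae_imply (ae_and dPi (ae_and dP dS)) => t [dPit [dPt dSt]] It.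
    have {}dPit := dPit It; have {}dPt := dPt It; have {}dSt := dSt It.
    have dcst := fun A : 'M[R[i]]_n => mx_has_deriv_cst A t.
    have := mx_has_derivD (mx_has_derivM (dcst A1) dSt)
      (mx_has_derivD (mx_has_derivN (mx_has_derivM dSt (dcst A2)))
        (mx_has_derivN (mx_has_derivM dPit dPt))).
    congr mx_has_deriv.
    rewrite mul0mx mulmx0 add0r addr0.
    rewrite !(mulmxDl, mulmxDr, mulmxN) !mulmxA !opprD !opprK.
    (* In the derivative of the defect each of these three products occurs once with each sign. *)
    move: (A1 *m Pi1 t *m Q1 t *m _) (Pi1 t *m Q1 t *m _ *m A2)
      (Pi1 t *m Q0 t *m _) => M1 M2 M3.
    by apply/matrixP => i j; rewrite !mxE; ring.
  have x0 : 0 <= x by case: Ix.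
  have := mx_ode_sol_cst itvl F0 I0 Ix x0.
  by rewrite /F !addrA id0 subrr => /eqP; rewrite subr_eq0 => /eqP.
split=> [a b Ia Ib ab|].
  have Iab x : a <= x <= b -> I x by move=> xab; exact: itvI Ia Ib x xab.
  have [Ja Jb] := (Isub a Ia, Isub b Ib).
  apply: mx_abs_cont_onM; last exact: acy.
  apply: mx_abs_cont_onD; first exact: mx_abs_cont_on_cst.
  apply: mx_abs_cont_onN; apply: mx_abs_cont_onM; last exact: acPi.
  apply: mx_abs_cont_onM; last exact: mx_abs_cont_on_cst.
  apply: mx_abs_cont_onM; first exact: acP.
  by apply: mx_abs_cont_onV => [x /Iab /uS //|]; exact: acS.
(* Off a common null set all four equations hold at [x], and only pointwise calculus remains. *)
apply: ae_imply (ae_and (ae_and dPi dP) (ae_and dS dy)) => x.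
move=> [[dPix dPx] [dSx dyx]] Ix; have Jx := Isub x Ix.
have {}dPix := dPix Jx; have {}dPx := dPx Jx.
have {}dSx := dSx Jx; have {}dyx := dyx Jx.
have dT := mx_has_derivV dSx (uS x Ix).
have dW := mx_has_derivD (mx_has_deriv_cst (1%:M : 'M[R[i]]_m) x)
  (mx_has_derivN (mx_has_derivM (mx_has_derivM (mx_has_derivM dPx dT)
    (mx_has_deriv_cst (invmx (A1 - lam%:M)) x)) dPix)).
have := mx_has_derivM dW dyx.
congr mx_has_deriv.
have := darboux_matrix_derivative (Q1 x) (Q0 x) (mulmxV (uS x Ix)) (mulVmx (uS x Ix))
  (mulmxV LU) (mulVmx LU) (id x Jx).
rewrite mulmx0 addr0 add0r => ->.
(* With [W] for [w_A], [L] and [L~] for the old and new coefficients,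
   [W' y + W y' = (W L - L~ W) y - W L y], and the terms [W L y] cancel. *)
by rewrite mulmxBl mulmxN addrAC -!mulmxA subrr add0r /Q0tilde /Xfun /wA -!mulmxA.
Qed.
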